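(* Let $k\geq 1$ be an integer and let $G$ be a non-bipartite $k$-extendable graph with $\nu(G)=4k$ vertices and minimum degree $\delta(G)$. Then: (1) if $\delta(G)\geq 3k$, then $G$ is $2k$-factor-critical; (2) if $\delta(G)=2k$, then $G$ is not $2k$-factor-critical; (3) if $2k+1\leq \delta(G)\leq 3k-1$, then $G$ is not $2k$-factor-critical if and only if there exists a partition of $V(G)$ into two sets $V_1$ and $V_2$ with $|V_1|=|V_2|=2k$ such that each of the induced subgraphs $G[V_1]$ and $G[V_2]$ consists of exactly two components, each of which is factor-critical and has at least $3$ vertices.
   Context: All graphs are undirected, simple, finite and connected. $\nu(G)$ is the number of vertices and $\delta(G)$ the minimum degree of $G$. A connected graph $G$ is $k$-extendable (for $0\leq k\leq (\nu(G)-2)/2$) if it contains a matching of size $k$ and every matching of size $k$ in $G$ is contained in a perfect matching of $G$. A graph $G$ is $n$-factor-critical (for $0\leq n\leq \nu(G)-2$) if $G-S$ has a perfect matching for every $S\subseteq V(G)$ with $|S|=n$. A graph $H$ is factor-critical if $H-v$ has a perfect matching for every vertex $v$ of $H$. *)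

(* Defs.v *)
From mathcomp Require Import all_boot.

Set Implicit Arguments.
Unset Strict Implicit.
Unset Printing Implicit Defensive.

(* A finite simple graph is its adjacency relation [e] on a vertex type
   [V : finType]; an induced subgraph G[A] is represented by [A : {set V}]. *)
Definition simple_graph (V : finType) (e : rel V) : Prop :=
  symmetric e /\ irreflexive e.

Definition connected (V : finType) (e : rel V) : Prop :=
  forall x y : V, connect e x y.

Definition bipartite (V : finType) (e : rel V) : Prop :=
  exists A : {set V}, forall x y : V, e x y -> (x \in A) != (y \in A).

Definition degree (V : finType) (e : rel V) (x : V) : nat :=
  #|[set y | e x y]|.

(* Every degree is at most #|V|, so for nonempty [V] the starting value of the
   iterated minimum never matters. *)
Definition min_degree (V : finType) (e : rel V) : nat :=
  \big[minn/#|V|]_(x : V) degree e x.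

Definition edges (V : finType) (e : rel V) : {set {set V}} :=
  [set [set p.1; p.2] | p : V * V & e p.1 p.2].

Definition matching (V : finType) (e : rel V) (M : {set {set V}}) : bool :=
  (M \subset edges e) && trivIset M.

(* A perfect matching of G[A]: [cover M = A] also forces the edges of [M] to
   lie inside [A]. *)
Definition perfect_matching (V : finType) (e : rel V) (A : {set V})
    (M : {set {set V}}) : bool :=
  matching e M && (cover M == A).

Definition has_perfect_matching (V : finType) (e : rel V) (A : {set V}) : Prop :=
  exists M : {set {set V}}, perfect_matching e A M.

Definition extendable (V : finType) (e : rel V) (k : nat) : Prop :=
  [/\ connected e,
      2 * k + 2 <= #|V|,
      exists M : {set {set V}}, matching e M /\ #|M| = k
    & forall M : {set {set V}}, matching e M -> #|M| = k ->
        exists2 N : {set {set V}}, perfect_matching e [set: V] N & M \subset N].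

Definition n_factor_critical (V : finType) (e : rel V) (n : nat) : Prop :=
  n + 2 <= #|V| /\
  forall S : {set V}, #|S| = n -> has_perfect_matching e (~: S).

(* G[A] is factor-critical. *)
Definition factor_critical (V : finType) (e : rel V) (A : {set V}) : Prop :=
  forall v : V, v \in A -> has_perfect_matching e (A :\ v).

Definition induced (V : finType) (e : rel V) (A : {set V}) : rel V :=
  [rel x y | [&& x \in A, y \in A & e x y]].

(* The vertex sets of the connected components of G[A]. *)
Definition components (V : finType) (e : rel V) (A : {set V}) : {set {set V}} :=
  equivalence_partition (connect (induced e A)) A.

Definition two_factor_critical_components (V : finType) (e : rel V)
    (A : {set V}) : Prop :=
  #|components e A| = 2 /\
  forall C : {set V}, C \in components e A -> factor_critical e C /\ 3 <= #|C|.

(* Main.v *)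
Require Import Defs.
From mathcomp Require Import all_boot.

(* Call a half [A] (a set of 2k vertices) bad if G[A] has no perfect matching. By
   k-extendability the complement of a bad half is bad, so G fails to be
   2k-factor-critical iff some half is bad, and switching along alternating paths
   yields a bad half missing only two vertices by a maximum matching.
   Let D(A) be the vertices of A missed by some maximum matching of G[A] and
   R(A) the rest; put B = ~: A. Extending a maximum matching of G[A] together with
   one crossing edge shows that D(A) has no neighbour in R(B), and symmetrically.
   If x in R(B) has a neighbour in D(B) and a is in D(A), exchanging a and x gives
   again a bad pair (A', B') with D(B') inside D(B). When D(B) is as small as
   possible this forces D(A) to be independent, and then, as the minimum degree
   exceeds 2k, two of the neighbourhoods have disjoint supersets D(B) + R(A) and
   D(A) + R(B), of total size 4k < 2(2k+1). Hence R(B) and R(A) are empty, and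
   Gallai's lemma splits G[A] and G[B] into two factor-critical components each. *)

Set Implicit Arguments.
Unset Strict Implicit.
Unset Printing Implicit Defensive.

(** * Pointwise proofs of set identities *)

Ltac bool_hyps :=
  repeat match goal with
  | H : is_true (_ && _) |- _ => case/andP: H; move=> ? ?
  | H : is_true (~~ (_ || _)) |- _ => rewrite negb_or in H
  | H : is_true (~~ ~~ _) |- _ => rewrite negbK in H
  | H : is_true (_ \in _ :\ _) |- _ => rewrite in_setD1 in H
  | H : is_true (_ \in _ |: _) |- _ => rewrite in_setU1 in H
  | H : is_true (_ \notin _ |: _) |- _ => rewrite in_setU1 in H
  | H : is_true (_ \in _ :\: _) |- _ => rewrite in_setD in H
  | H : is_true (_ \in ~: _) |- _ => rewrite in_setC in H
  | H : is_true (_ \notin ~: _) |- _ => rewrite in_setC in H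
  end.

Ltac use_bools :=
  repeat match goal with
  | |- context [?x == ?x] => rewrite eqxx
  | H : is_true (~~ ?b) |- context [?b] => rewrite (negbTE H)
  | H : is_true (~~ (?x == ?y)) |- context [?y == ?x] =>
      rewrite [y == x]eq_sym (negbTE H)
  | H : is_true ?b |- context [?b] => rewrite H
  end;
  rewrite ?andbF ?andbT ?orbF ?orbT //=.

Ltac neq_by_mem h :=
  lazymatch type of h with ?u = ?y =>
    match goal with
    | H : is_true (~~ (u \in ?A)), H' : is_true (y \in ?A) |- _ =>
        exfalso; move/negP: H; apply; rewrite h; exact: H'
    | H : is_true (~~ (y \in ?A)), H' : is_true (u \in ?A) |- _ =>
        exfalso; move/negP: H; apply; rewrite -h; exact: H'
    end
  end.

(** Splits on whether the point is one of the named vertices and refutes the remaining coincidences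
    by membership. *)
Ltac set_points :=
  bool_hyps; let w := fresh "w" in apply/setP => w; rewrite !inE;
  repeat match goal with
  | |- context [w == ?y] =>
      let h := fresh "h" in
      case: (eqVneq w y) => h; [subst w; use_bools | use_bools]
  end; use_bools;
  repeat match goal with
  | |- context [?u == ?y] =>
      let h := fresh "h" in
      case: (eqVneq u y) => h; [neq_by_mem h | use_bools]
  end.

(** * Vertex sets of matchings *)

Section Matchable.

Variables (V : finType) (e : rel V).
Hypotheses (esym : symmetric e) (eirr : irreflexive e).

Implicit Types (x y z : V) (A B C X Y : {set V}).

(** Switching arguments need only the vertex set that a matching covers, so its edges are forgotten;
    the boolean form allows case analysis. *)
Definition matchable X : bool := [exists M, perfect_matching e X M].

Lemma matchableP X : reflect (has_perfect_matching e X) (matchable X).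
Proof. exact: existsP. Qed.

Lemma matchable0 : matchable set0.
Proof.
apply/existsP; exists set0; rewrite /perfect_matching /matching sub0set /=.
apply/andP; split; last by rewrite /cover big_set0.
by apply/trivIsetP => A B; rewrite inE.
Qed.

Lemma adj_neq x y : e x y -> x != y.
Proof. by move=> exy; apply: contraTneq exy => ->; rewrite eirr. Qed.

Lemma matchable_add x y X :
  e x y -> x \notin X -> y \notin X -> matchable X -> matchable (x |: (y |: X)).
Proof.
move=> exy xX yX /existsP[M /andP[/andP[Me Mt] /eqP cM]].
have dM : [disjoint [set x; y] & cover M].
  rewrite cM -setI_eq0; apply/eqP/setP => w; rewrite !inE.
  by apply/andP => -[/orP[]/eqP-> wX]; [rewrite wX in xX | rewrite wX in yX].
apply/existsP; exists ([set x; y] |: M); apply/andP; split; last first.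
  by rewrite /cover bigcup_setU big_set1 -/(cover M) cM setUA.
apply/andP; split.
  rewrite subUset Me andbT sub1set; apply/imsetP; exists (x, y) => //.
  by rewrite inE.
by apply: trivIsetU; rewrite ?trivIset1 // cover1.
Qed.

Lemma matchable_del x X : matchable X -> x \in X ->
  exists y, [/\ e x y, y \in X & matchable (X :\ x :\ y)].
Proof.
move=> /existsP[M /andP[/andP[Me Mt] /eqP cM]].
rewrite -{1}cM => /bigcupP[E EM xE].
have /imsetP[[a b] /=] := subsetP Me _ EM.
rewrite inE => /= eab defE.
have mE : matchable (X :\: E).
  apply/existsP; exists (M :\ E).
  rewrite /perfect_matching coverD1 // cM eqxx andbT /matching trivIsetD // andbT.
  by apply: subset_trans Me; apply: subD1set.
have EX w : w \in E -> w \in X.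
  by move=> wE; rewrite -cM; apply/bigcupP; exists E.
rewrite defE !inE in xE; case/orP: xE => /eqP ->.
  exists b; split=> //; first by apply: EX; rewrite defE !inE eqxx orbT.
  by rewrite setDDl -defE.
exists a; split; first by rewrite esym.
  by apply: EX; rewrite defE !inE eqxx.
by rewrite setDDl setUC -defE.
Qed.

Lemma matchable_ind (P : {set V} -> Prop) :
  P set0 ->
  (forall x y X, e x y -> x \notin X -> y \notin X -> matchable X ->
     P X -> P (x |: (y |: X))) ->
  forall X, matchable X -> P X.
Proof.
move=> P0 PU X; move: {2}#|X| (leqnn #|X|) => n.
elim: n X => [|n IHn] X.
  by rewrite leqn0 cards_eq0 => /eqP->.
move=> leX mX; case: (set_0Vmem X) => [->//|[x xX]].
have [y [exy yX mX']] := matchable_del mX xX.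
have nxy := adj_neq exy.
have -> : X = x |: (y |: (X :\ x :\ y)).
  by set_points.
apply: PU => //; try by rewrite !inE ?eqxx ?andbF.
apply: IHn => //; move: leX; rewrite (cardsD1 x) xX (cardsD1 y) !inE.
by rewrite eq_sym nxy yX /= => /ltnW.
Qed.

Lemma matchable_even X : matchable X -> ~~ odd #|X|.
Proof.
move=> mX; elim/matchable_ind: X / mX; first by rewrite cards0.
move=> x y X exy xX yX _ IH; rewrite !cardsU1 !inE (negbTE (adj_neq exy)).
by rewrite (negbTE xX) yX /= negbK.
Qed.

(** By symmetry of [e], the closure hypothesis puts each matching edge wholly inside or wholly
    outside [C]; those inside match [X :&: C]. *)
Lemma matchable_restrict X C :
  (forall x y, x \in C -> y \in X -> e x y -> y \in C) ->
  matchable X -> matchable (X :&: C).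
Proof.
move=> + mX; elim/matchable_ind: X / mX => [|x y X exy xX yX _ IH] clC.
  by rewrite set0I matchable0.
have {}IH : matchable (X :&: C).
  by apply: IH => u v uC vX; apply: clC => //; rewrite !inE vX !orbT.
have exC : (x \in C) = (y \in C).
  apply/idP/idP => [xC|yC].
    by apply: clC xC _ exy; rewrite !inE eqxx orbT.
  by apply: clC yC _ _; rewrite ?inE ?eqxx // esym.
case xC: (x \in C); last first.
  suff -> : (x |: (y |: X)) :&: C = X :&: C by [].
  rewrite !setIUl; suff -> : [set x] :&: C = set0.
    suff -> : [set y] :&: C = set0 by rewrite !set0U.
    by apply/setP => w; rewrite !inE; case: eqP => //= ->; rewrite -exC.
  by apply/setP => w; rewrite !inE; case: eqP => //= ->.
have -> : (x |: (y |: X)) :&: C = x |: (y |: (X :&: C)).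
  apply/setP => w; rewrite !inE; case: eqP => [->|_] //=.
  by case: eqP => [->|_] //=; rewrite -exC.
by apply: matchable_add => //; rewrite inE negb_and ?xX ?yX.
Qed.

(* [X] and [Y] stand for the vertex sets of two matchings; [z] is the other end
   of the component through [y] of their symmetric difference, along which the
   two matchings are switched. *)
Lemma matchable_exchange X Y y :
  matchable X -> matchable Y -> y \in X -> y \notin Y ->
  exists2 z, z != y &
    [/\ z \in Y, z \notin X, matchable (z |: (X :\ y))
      & matchable (y |: (Y :\ z))] \/
    [/\ z \in X, z \notin Y, matchable (X :\ y :\ z)
      & matchable (y |: (z |: Y))].
Proof.
move: {2}#|X| (leqnn #|X|) => n.
elim: n X Y y => [|n IHn] X Y y.
  by rewrite leqn0 cards_eq0 => /eqP-> _ _; rewrite inE.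
move=> leX mX mY yX yY; have [y1 [eyy1 y1X mX1]] := matchable_del mX yX.
have ny1 := adj_neq eyy1.
have [y1Y|y1Y] := boolP (y1 \in Y); last first.
  exists y1; first by rewrite eq_sym.
  right; split=> //; exact: matchable_add.
have [y2 [e12 y2Y mY1]] := matchable_del mY y1Y.
have ny2 := adj_neq e12.
have nyy2 : y2 != y by apply: contraNneq yY => <-.
have [y2X|y2X] := boolP (y2 \in X); last first.
  exists y2 => //; left; split=> //.
    have -> : y2 |: (X :\ y) = y1 |: (y2 |: (X :\ y :\ y1)) by set_points.
    by apply: matchable_add; rewrite // !inE ?eqxx ?(negbTE y2X) ?andbF.
  have -> : y |: (Y :\ y2) = y |: (y1 |: (Y :\ y1 :\ y2)) by set_points.
  apply: matchable_add; rewrite // !inE ?eqxx ?(negbTE yY) ?andbF //.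
(* The edges [y y1] and [y1 y2] are removed, and the alternating path goes on from [y2], now covered
   by the first matching only. *)
have [|||||z nz2] := IHn (X :\ y :\ y1) (Y :\ y1 :\ y2) y2 => //.
- by move: leX; rewrite (cardsD1 y) yX (cardsD1 y1) !inE eq_sym ny1 y1X => /ltnW.
- by rewrite !inE nyy2 y2X eq_sym ny2.
- by rewrite !inE eqxx.
case=> [[zY zX m1 m2]|[zX zY m1 m2]].
- have [z1 {}zY] : z != y1 /\ z \in Y by move: zY; rewrite !inE => /and3P[].
  have nzy : z != y by apply: contraNneq yY => <-.
  have {}zX : z \notin X by move: zX; rewrite !inE nzy z1.
  exists z => //; left; split=> //.
    have -> : z |: (X :\ y) = y1 |: (y2 |: (z |: (X :\ y :\ y1 :\ y2))).
      by set_points.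
    apply: matchable_add; rewrite // !inE ?eqxx ?[_ == z]eq_sym ?(negbTE nz2);
      by rewrite ?(negbTE z1) ?andbF.
  have -> : y |: (Y :\ z) = y |: (y1 |: (y2 |: (Y :\ y1 :\ y2 :\ z))).
    by set_points.
  apply: matchable_add; rewrite // !inE ?eqxx ?(negbTE yY) ?andbF ?orbF ?(negbTE ny2) //.
  by rewrite eq_sym.
have [z1 nzy zX'] : [/\ z != y1, z != y & z \in X] by move: zX; rewrite !inE => /and3P[].
have {}zY : z \notin Y by move: zY; rewrite !inE nz2 z1.
exists z => //; right; split=> //.
  have -> : X :\ y :\ z = y1 |: (y2 |: (X :\ y :\ y1 :\ y2 :\ z)) by set_points.
  by apply: matchable_add; rewrite // !inE ?eqxx ?andbF.
have -> : y |: (z |: Y) = y |: (y1 |: (y2 |: (z |: (Y :\ y1 :\ y2)))).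
  by set_points.
apply: matchable_add => //; rewrite !inE ?eqxx ?(negbTE yY) ?andbF ?orbF
  ?(negbTE ny2) ?negb_or ?nyy2 //.
- by rewrite eq_sym nyy2 eq_sym nzy.
- by rewrite eq_sym z1.
Qed.

End Matchable.

(** * Bad halves *)

Section Exposable.

Variables (V : finType) (e : rel V) (k : nat).
Hypotheses (esym : symmetric e) (eirr : irreflexive e).
Hypothesis cardV : #|V| = 4 * k.
Hypothesis deg_gt : forall v, 2 * k < degree e v.
Hypothesis matchableC :
  forall X : {set V}, #|X| = 2 * k -> matchable e X -> matchable e (~: X).

Implicit Types (a d u v x y z : V) (A B X Y : {set V}).

(* For a half [A] that just fails to have a perfect matching, these are the
   vertices missed by some maximum matching of G[A]: the set D(A) of the
   Gallai-Edmonds decomposition. Locked so that [inE] does not unfold it. *)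
Definition exposable A : {set V} :=
  locked
  [set u in A | [exists v, [&& v \in A, v != u & matchable e (A :\ u :\ v)]]].

Definition unexposable A : {set V} := A :\: exposable A.

(** A bad half of deficiency exactly two: a nonempty [exposable A] says that deleting some pair of
    vertices leaves a matchable set. *)
Definition near_matchable A :=
  [/\ #|A| = 2 * k, ~~ matchable e A & exposable A != set0].

Lemma exposableP A u :
  reflect (exists v, [/\ u \in A, v \in A, v != u & matchable e (A :\ u :\ v)])
          (u \in exposable A).
Proof.
rewrite /exposable -lock inE; apply: (iffP andP) => [[uA /existsP[v /and3P[vA vu m]]]|].
  by exists v.
by case=> v [uA vA vu m]; split=> //; apply/existsP; exists v; apply/and3P.
Qed.

Lemma exposable_pair A u v : u \in A -> v \in A -> v != u ->
  matchable e (A :\ u :\ v) -> u \in exposable A /\ v \in exposable A.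
Proof.
move=> uA vA vu m; split; apply/exposableP; first by exists v.
exists u; split=> //; first by rewrite eq_sym.
by have -> : A :\ v :\ u = A :\ u :\ v by rewrite !setDDl setUC.
Qed.

Lemma exposable_sub A : exposable A \subset A.
Proof. by apply/subsetP => u /exposableP[v []]. Qed.

Lemma card_half A : #|A| = 2 * k -> #|~: A| = 2 * k.
Proof.
by move=> cA; apply/eqP; rewrite -(eqn_add2l #|A|) cardsC cardV cA -mulnDl.
Qed.

Lemma swapC A a x : a \in A -> x \notin A ->
  ~: (x |: (A :\ a)) = a |: (~: A :\ x).
Proof. by move=> aA xA; set_points. Qed.

Lemma card_swap A a x : a \in A -> x \notin A -> #|x |: (A :\ a)| = #|A|.
Proof.
by move=> aA xA; rewrite cardsU1 !inE (negbTE xA) andbF (cardsD1 a A) aA.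
Qed.

Lemma nbr_card v (Z : {set V}) : (forall y, e v y -> y \in Z) -> 2 * k < #|Z|.
Proof.
move=> sZ; apply: leq_trans (deg_gt v) _; apply: subset_leq_card.
by apply/subsetP => y; rewrite inE; apply: sZ.
Qed.

(** If [a] and [v] are missed together, the edge [a x] makes the half [A - v + x] matchable, hence
    also its complement; deleting there the edge at [v] leaves [~: A] without [x] and one more
    vertex. *)
Lemma exposable_nbr A a x : #|A| = 2 * k ->
  a \in exposable A -> x \notin A -> e a x -> x \in exposable (~: A).
Proof.
move=> cA /exposableP[v [aA vA va m]] xA eax.
have m1 : matchable e (x |: (A :\ v)).
  have -> : x |: (A :\ v) = a |: (x |: (A :\ a :\ v)) by set_points.
  by apply: matchable_add; rewrite // !inE ?eqxx ?(negbTE xA) ?andbF.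
have /(matchable_del esym) m2 := matchableC (etrans (card_swap vA xA) cA) m1.
have [|y [evy yX {}m2]] := m2 v; first by rewrite swapC // !inE eqxx.
have nyv : y != v by rewrite eq_sym; apply: adj_neq evy.
move: yX m2; rewrite swapC // !inE (negbTE nyv) /= => /andP[nyx yA] m2.
apply/exposableP; exists y; rewrite !inE; split=> //.
suff -> : ~: A :\ x :\ y = (v |: (~: A :\ x)) :\ v :\ y by [].
by set_points.
Qed.

(** A degree above [2 * k] gives an exposable vertex a neighbour outside [A], to which
    [exposable_nbr] applies. *)
Lemma near_matchableC A : near_matchable A -> near_matchable (~: A).
Proof.
case=> cA nA /set0Pn[a aD]; split; first exact: card_half.
  apply: contra nA => /matchableC; rewrite setCK; apply; exact: card_half.
apply/set0Pn; have [x eax xA] : exists2 x, e a x & x \notin A.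
  apply/exists_inP; rewrite -negb_forall_in; apply/negP => /forall_inP sA.
  by have := nbr_card sA; rewrite cA ltnn.
by exists x; apply: exposable_nbr eax.
Qed.

(** A matchable [X] inside a bad half is enlarged by augmenting paths, exchanging a vertex of the
    half whenever a path ends outside it. *)
Lemma exists_near_matchable A : matchable e [set: V] ->
  #|A| = 2 * k -> ~~ matchable e A -> exists A', near_matchable A'.
Proof.
move=> mV; suff main n X : X \subset A -> matchable e X -> 2 * k - #|X| < n ->
    #|A| = 2 * k -> ~~ matchable e A -> exists A', near_matchable A'.
  by apply: (main (2 * k).+1 set0); rewrite ?sub0set ?matchable0 // cards0 subn0.
elim: n A X => [|n IHn] A X // sXA mX ltn cA nA.
(* Parity provides a second uncovered vertex [a], to be given up when the path leaves [A]. *)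
have eX : ~~ odd #|A :\: X|.
  rewrite cardsD (setIidPr sXA) oddB ?subset_leq_card // cA mul2n odd_double.
  exact: matchable_even mX.
have [E|[y]] := set_0Vmem (A :\: X).
  case/negP: nA; suff -> : A = X by [].
  by apply/eqP; rewrite eqEsubset sXA andbT -setD_eq0 E.
rewrite in_setD => /andP[yX yA].
have [a] : exists a, a \in A :\: X :\ y.
  apply/set0Pn; rewrite -cards_eq0; apply: contraNneq eX => E.
  by rewrite (cardsD1 y) E !inE yX yA.
rewrite !inE => /and3P[nay aX aA].
(* Against a perfect matching of G the path from [y] must augment [X], since no [z] lies outside
   [[set: V]]. *)
have [|z nzy] := matchable_exchange esym eirr mV mX _ yX; first by rewrite inE.
case=> [[_]|[_ zX _ mX']]; first by rewrite inE.
have card' : #|y |: (z |: X)| = #|X|.+2.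
  by rewrite !cardsU1 !inE zX (negbTE yX) eq_sym (negbTE nzy).
have lt' : 2 * k - #|y |: (z |: X)| < n.
  rewrite card' -ltnS; apply: leq_trans ltn; rewrite ltnS ltn_sub2l //.
  rewrite -cA; apply: proper_card; rewrite properE sXA /=.
  by apply/negP => /subsetP/(_ _ yA); rewrite (negbTE yX).
have [zA|zA] := boolP (z \in A).
  apply: IHn mX' lt' cA nA; rewrite !subUset !sub1set yA zA //=.
have cA' : #|z |: (A :\ a)| = 2 * k by rewrite card_swap.
(* If the exchanged half is matchable, deleting its edge at [z] shows that [A] misses only [a] and
   the partner of [z]. *)
have [mA'|nA'] := boolP (matchable e (z |: (A :\ a))); last first.
  apply: IHn mX' lt' cA' nA'; rewrite !subUset !sub1set !inE eqxx yA [y == a]eq_sym nay.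
  rewrite orbT /=; apply/subsetP => w wX; rewrite !inE (subsetP sXA) // andbT.
  by rewrite (memPn aX) // orbT.
have [|u [ezu uA mu]] := matchable_del esym mA' (x := z).
  by rewrite !inE eqxx.
have nuz := adj_neq eirr ezu.
move: uA; rewrite !inE eq_sym (negbTE nuz) /= => /andP[nua uA].
exists A; split=> //; apply/set0Pn; exists a; apply/exposableP; exists u.
split=> //; suff -> : A :\ a :\ u = (z |: (A :\ a)) :\ z :\ u by [].
by set_points.
Qed.

(** * Exchanging a vertex of D(A) with one of R(B) *)

Section Swap.

Variables (A : {set V}) (a x : V).
Hypotheses (nmA : near_matchable A) (aD : a \in exposable A).
Hypothesis xR : x \in unexposable (~: A).

Let aA : a \in A. Proof. exact: subsetP (exposable_sub A) _ aD. Qed.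

Let xA : x \notin A. Proof. by move: xR; rewrite !inE => /andP[]. Qed.

Let xD : x \notin exposable (~: A).
Proof. by move: xR; rewrite in_setD => /andP[]. Qed.

Let S := x |: (A :\ a).

(** Deleting [x] from [S] or [a] from [A] leaves the same set. If [S] were matchable, the partner of
    [x] would be exposable in [A], making its neighbour [x] exposable in [~: A]. *)
Lemma swap_near_matchable : near_matchable S /\ x \in exposable S.
Proof.
have [cA nA _] := nmA.
have xS : x \in exposable S.
  have /exposableP[v [_ vA va m]] := aD.
  have nvx : v != x by apply: contraNneq xA => <-.
  apply/exposableP; exists v; rewrite !inE eqxx va vA orbT; split=> //.
  suff -> : S :\ x :\ v = A :\ a :\ v by [].
  by rewrite /S; set_points.
split=> //; split; first by rewrite card_swap.
  apply/negP => mS.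
  have [|u [exu uS mu]] := matchable_del esym mS (x := x).
    by rewrite !inE eqxx.
  have nxu := adj_neq eirr exu.
  move: uS; rewrite !inE eq_sym (negbTE nxu) /= => /andP[nua uA].
  have uD : u \in exposable A.
    apply: (proj2 (exposable_pair aA uA nua _)).
    suff -> : A :\ a :\ u = S :\ x :\ u by [].
    by rewrite /S; set_points.
  by move/negP: xD; apply; apply: exposable_nbr uD xA _; rewrite // esym.
by apply/set0Pn; exists x.
Qed.

Lemma swap_unexposable : a \in unexposable (~: S).
Proof.
rewrite /unexposable in_setD /S swapC // !inE eqxx andbT.
apply/negP => /exposableP[v [_ + nva mv]]; rewrite !inE (negbTE nva) /=.
move=> /andP[nvx vA]; move/negP: xD; apply.
apply/exposableP; exists v; rewrite !inE; split=> //.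
suff -> : ~: A :\ x :\ v = (a |: (~: A :\ x)) :\ a :\ v by [].
by set_points.
Qed.

(* This is the stability lemma of matching theory: if the switch from [y] ends at
   [x], the edge [x d] re-covers [x]. *)
Lemma swap_exposable_sub d : d \in exposable (~: A) -> e x d ->
  exposable (~: S) \subset exposable (~: A).
Proof.
move=> dD exd; apply/subsetP => y yS; apply: contraT => yD.
have := swap_unexposable; rewrite in_setD => /andP[aDS _].
have /exposableP[v [yB vB nvy mY]] := yS.
have [_ vS] := exposable_pair yB vB nvy mY.
have nay : a != y by apply: contraNneq aDS => ->.
have nav : a != v by apply: contraNneq aDS => ->.
(* Since [a] is unexposable in [~: S], it is covered; dropping its edge gives a matching inside
   [~: A] that misses exactly [x], [y], [v], [z]. *)
have [|z [eaz zY mN]] := matchable_del esym mY (x := a).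
  by rewrite /S swapC // !inE eqxx nay nav.
have naz := adj_neq eirr eaz.
have := dD => /exposableP[d' [dA d'A nd'd mM]].
have [_ d'D] := exposable_pair dA d'A nd'd mM.
rewrite !in_setC in dA d'A.
move: yB vB zY mN; rewrite /S swapC // !inE ![_ == a]eq_sym.
rewrite (negbTE nay) (negbTE nav) (negbTE naz) /=.
move=> /andP[nyx yA] /andP[nvx vA] /and4P[nzv nzy nzx zA] mN.
have noxy w : w \notin A -> w != x -> ~ matchable e (~: A :\ x :\ w).
  move=> wA nwx m; move/negP: xD; apply; apply/exposableP; exists w.
  by rewrite !inE.
have noyw w : w \notin A -> y != w -> ~ matchable e (~: A :\ y :\ w).
  move=> wA nyw m; move/negP: yD; apply; apply/exposableP; exists w.
  by rewrite !inE eq_sym.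
have nyd : y != d by apply: contraNneq yD => ->.
have nyd' : y != d' by apply: contraNneq yD => ->.
have nxd : x != d by apply: contraNneq xD => ->.
have nxd' : x != d' by apply: contraNneq xD => ->.
(* The matching missing [d] and [d'] is switched from [y] against the one missing [x], [y], [v],
   [z]. The end [w] is [d] or [d'] in the first case and [x], [v] or [z] in the second; each choice
   makes [x] or [y] exposable in [~: A]. *)
have [||w nwy] := matchable_exchange esym eirr mM mN (y := y).
- by rewrite !inE nyd nyd' yA.
- by rewrite !inE eqxx !andbF.
case=> [[wN wM mw _]|[wM wN mw1 mw2]].
  move: wN wM; rewrite !inE => /and5P[wz wa wv _].
  rewrite (negbTE wa) /= => /andP[wx wA]; rewrite wA andbT.
  rewrite negb_and !negbK => /orP[/eqP E|/eqP E]; subst w.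
    case: (noyw d) => //.
    suff -> : ~: A :\ y :\ d = d' |: (~: A :\ d :\ d' :\ y) by [].
    by set_points.
  case: (noyw d') => //.
  suff -> : ~: A :\ y :\ d' = d |: (~: A :\ d :\ d' :\ y) by [].
  by set_points.
have wA : w \notin A by move: wM; rewrite !inE => /and3P[].
have nwa : w != a by apply: contraNneq wA => ->.
have [Ew|nwx] := eqVneq w x.
  subst w; case: (noyw d') => //.
  suff -> : ~: A :\ y :\ d' = x |: (d |: (~: A :\ d :\ d' :\ y :\ x)).
    by apply: matchable_add => //; rewrite !inE ?eqxx ?andbF.
  by set_points.
have [Ew|nwv] := eqVneq w v.
  subst w; case: (noxy z) => //.
  suff -> : ~: A :\ x :\ z = y |: (v |: ((a |: (~: A :\ x)) :\ y :\ v :\ a :\ z)) by [].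
  by set_points.
have [Ew|nwz] := eqVneq w z.
  subst w; case: (noxy v) => //.
  suff -> : ~: A :\ x :\ v = y |: (z |: ((a |: (~: A :\ x)) :\ y :\ v :\ a :\ z)) by [].
  by set_points.
by move: wN; rewrite !inE nwz nwa nwv nwy nwx wA orbT.
Qed.

End Swap.

(* Otherwise the neighbours of an exposable and of an unexposable vertex of
   [~: A] lie in complementary sets, too small for two degrees above [2 * k]. *)
Lemma unexposable_nbr A : near_matchable A -> unexposable (~: A) != set0 ->
  exists x d, [/\ x \in unexposable (~: A), d \in exposable (~: A) & e x d].
Proof.
move=> nmA /set0Pn[r rR]; have nmB := near_matchableC nmA.
have [cA nA _] := nmA; have [cB nB /set0Pn[v vD]] := nmB.
have [/exists_inP[x xR /exists_inP[d dD exd]]|noRD] := boolP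
  [exists x in unexposable (~: A), exists d in exposable (~: A), e x d].
  by exists x, d.
have {}noRD x d : x \in unexposable (~: A) -> d \in exposable (~: A) -> ~~ e x d.
  move=> xR dD; apply: contra noRD => exd.
  by apply/exists_inP; exists x => //; apply/exists_inP; exists d.
have Nv : 2 * k < #|exposable A :|: exposable (~: A)|.
  apply: (@nbr_card v) => y evy; rewrite in_setU; have [yA|yA] := boolP (y \in A).
    apply/orP; left; rewrite -[A]setCK; apply: exposable_nbr cB vD _ evy.
    by rewrite inE negbK.
  apply/orP; right; apply: contraT => yD; have := noRD y v; rewrite esym evy.
  by apply=> //; rewrite !in_setD yD inE yA.
have Nr : 2 * k < #|~: (exposable A :|: exposable (~: A))|.
  apply: (@nbr_card r) => y ery; rewrite in_setC in_setU negb_or.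
  have rA : r \notin A by move: rR; rewrite !inE => /andP[].
  apply/andP; split; apply/negP => yD.
    have : r \in exposable (~: A) by apply: exposable_nbr yD rA _; rewrite // esym.
    by move: rR; rewrite in_setD => /andP[/negbTE->].
  by have := noRD _ _ rR yD; rewrite ery.
have := cardsC (exposable A :|: exposable (~: A)); rewrite cardV => E.
have := leq_add Nv Nr; rewrite addSn addnS E -mulnDl => H.
by move: (leq_trans (leqnSn _) H); rewrite ltnn.
Qed.

(** Swapping [x] into the half makes it exposable, so an adjacent [y] is exposable in the new
    complement and, by [swap_exposable_sub], already in the old one. *)
Lemma unexposable_indep A x d y : near_matchable A ->
  x \in unexposable (~: A) -> d \in exposable (~: A) -> e x d ->
  y \in unexposable (~: A) -> ~~ e x y.
Proof.
move=> nmA xR dD exd yR; apply/negP => exy.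
have [cA _ /set0Pn[a aD]] := nmA.
have [[cS _ _] xS] := swap_near_matchable nmA aD xR.
have sub := swap_exposable_sub aD xR dD exd.
have nxy := adj_neq eirr exy.
have yA : y \notin A by move: yR; rewrite !inE => /andP[].
have : y \in exposable (~: (x |: (A :\ a))).
  by apply: exposable_nbr xS _ exy; rewrite // !inE eq_sym negb_or nxy (negbTE yA) andbF.
by move/(subsetP sub); move: yR; rewrite in_setD => /andP[/negbTE->].
Qed.

Lemma exposable_unexposable A a y : #|A| = 2 * k ->
  a \in exposable A -> y \in unexposable (~: A) -> ~~ e a y.
Proof.
move=> cA aD; rewrite in_setD in_setC => /andP[yD yA].
by apply: contra yD; apply: exposable_nbr.
Qed.

Lemma unexposable0 A : near_matchable A -> unexposable (~: A) = set0.
Proof.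
move: {2}#|_| (leqnn #|exposable (~: A)|) => n.
elim: n A => [|n IHn] A leD nmA.
  have [_ _ /negP[]] := near_matchableC nmA.
  by rewrite -cards_eq0 -leqn0.
apply/eqP; apply: contraT => RB0.
have [x [d [xR dD exd]]] := unexposable_nbr nmA RB0.
have [cA _ /set0Pn[a aD]] := nmA.
have nmB := near_matchableC nmA; have [cB _ _] := nmB.
have inpart y A' : y \in A' -> y \notin exposable A' -> y \in unexposable A'.
  by move=> yA yD; rewrite in_setD yD.
have indep u v : u \in exposable A -> v \in exposable A -> ~~ e u v.
  move=> uD vD; apply/negP => euv.
  have [nmS xS] := swap_near_matchable nmA uD xR; have [cS _ _] := nmS.
  have uR := swap_unexposable uD xR.
  have sub := swap_exposable_sub uD xR dD exd.
  have nuv := adj_neq eirr euv.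
  have uA := subsetP (exposable_sub A) _ uD.
  have vA := subsetP (exposable_sub A) _ vD.
  set S := x |: (A :\ u) in nmS cS xS uR sub.
  have vS : v \in S by rewrite !inE vA [v == u]eq_sym nuv orbT.
  (* A strictly smaller set would let the induction hypothesis empty [unexposable (~: S)], which
     contains [u]. *)
  have eqD : exposable (~: S) = exposable (~: A).
    apply/eqP; rewrite eqEcard sub /= leqNgt; apply/negP => ltD.
    have := IHn S (leq_trans ltD leD) nmS => /setP/(_ u).
    by rewrite uR inE.
  have vDS : v \notin exposable S.
    apply/negP => vDS; have := exposable_unexposable cS vDS uR.
    by rewrite esym euv.
  suff : 2 * k < #|A| by rewrite cA ltnn.
  (* A neighbour of [v] outside [A] would be exposable in [~: A], hence in [~: S], yet adjacent to
     [v], which is unexposable in [S]. *)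
  apply: (@nbr_card v) => y evy; apply: contraT => yA.
  have yD : y \in exposable (~: A) by apply: exposable_nbr vD yA evy.
  have := @exposable_unexposable (~: S) y v (card_half cS).
  rewrite eqD setCK => /(_ yD (inpart _ _ vS vDS)).
  by rewrite esym evy.
have N1 : 2 * k < #|exposable (~: A) :|: unexposable A|.
  apply: (@nbr_card a) => y eay; rewrite in_setU.
  have [yA|yA] := boolP (y \in A).
    rewrite (inpart y A) ?orbT //; apply/negP => yD.
    by have := indep _ _ aD yD; rewrite eay.
  by rewrite (exposable_nbr cA aD yA eay).
(* The set bounded in [N1] exceeds a half, so D(B) alone cannot fill it; [unexposable_nbr] then
   applies with the two halves exchanged. *)
have RA0 : unexposable (~: ~: A) != set0.
  rewrite setCK; apply: contraTneq N1 => ->; rewrite setU0 -leqNgt -cB.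
  by apply: subset_leq_card; apply: exposable_sub.
have [w [c [wR cD ewc]]] := unexposable_nbr nmB RA0.
have indepw := unexposable_indep nmB wR cD ewc; rewrite setCK in wR indepw.
have N2 : 2 * k < #|~: (exposable (~: A) :|: unexposable A)|.
  apply: (@nbr_card w) => y ewy; rewrite in_setC in_setU negb_or.
  apply/andP; split; apply/negP => yD; last first.
    by have := indepw _ yD; rewrite ewy.
  have := @exposable_unexposable (~: A) y w cB yD.
  by rewrite setCK esym ewy => /(_ wR).
have := cardsC (exposable (~: A) :|: unexposable A); rewrite cardV => E.
have := leq_add N1 N2; rewrite addSn addnS E -mulnDl => H.
by move: (leq_trans (leqnSn _) H); rewrite ltnn.
Qed.

End Exposable.

(** * Factor-critical components *)

Section Components.

Variables (V : finType) (e : rel V).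
Hypotheses (esym : symmetric e) (eirr : irreflexive e).

Implicit Types (u v w x y : V) (A C X : {set V}).

Lemma connect_induced_sym A : connect_sym (induced e A).
Proof.
by apply: sym_connect_sym => x y; rewrite /induced /= esym andbCA.
Qed.

Lemma connect_closed (r : rel V) A u w :
  (forall x y, x \in A -> r x y -> y \in A) ->
  connect r u w -> u \in A -> w \in A.
Proof.
move=> clA /connectP[p + ->]; elim: p u => //= x p IHp u /andP[rux pth] uA.
by apply: IHp pth _; apply: clA uA rux.
Qed.

Lemma componentsP A C :
  reflect (exists2 u, u \in A & C = [set y in A | connect (induced e A) u y])
          (C \in components e A).
Proof. exact: imsetP. Qed.

Lemma component_eq A C u : C \in components e A -> u \in C ->
  u \in A /\ C = [set y in A | connect (induced e A) u y].
Proof.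
case/componentsP=> x xA ->; rewrite inE => /andP[uA xu]; split=> //.
apply/setP => y; rewrite !inE.
by rewrite (same_connect (connect_induced_sym A) xu).
Qed.

Lemma component_sub A C : C \in components e A -> C \subset A.
Proof. by move=> cC; apply/subsetP => u /(component_eq cC)[]. Qed.

Lemma component_neq0 A C : C \in components e A -> exists u, u \in C.
Proof. by case/componentsP=> u uA ->; exists u; rewrite inE uA connect0. Qed.

Lemma component_closed A C x y : C \in components e A ->
  x \in C -> y \in A -> e x y -> y \in C.
Proof.
move=> cC xC yA exy; have [xA ->] := component_eq cC xC.
by rewrite inE yA connect1 // /induced /= xA yA.
Qed.

Lemma components_partition A : partition (components e A) A.
Proof.
apply: equivalence_partitionP => x y z _ _ _; split; first exact: connect0.
by move/(same_connect (connect_induced_sym A)) ->.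
Qed.

Lemma matchable_component A X C : C \in components e A -> X \subset A ->
  matchable e X -> matchable e (X :&: C).
Proof.
move=> cC /subsetP sXA; apply: matchable_restrict => // x y xC yX.
by apply: component_closed xC (sXA y yX).
Qed.

Lemma factor_critical_odd C u : factor_critical e C -> u \in C -> odd #|C|.
Proof.
move=> fC uC; have /matchableP/(matchable_even esym eirr) := fC u uC.
by rewrite (cardsD1 u C) uC.
Qed.

(** Strict because [u] is counted in [C] but is not its own neighbour. *)
Lemma degree_component A C u : C \in components e A -> u \in C ->
  degree e u < #|C| + #|~: A|.
Proof.
move=> cC uC; rewrite (cardsD1 u C) uC addSn ltnS.
apply: leq_trans _ (leq_of_leqif (leq_card_setU _ _)); apply: subset_leq_card.
apply/subsetP => y; rewrite !inE => euy; rewrite eq_sym (adj_neq eirr euy) /=.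
have [yA|yA] := boolP (y \in A); last by rewrite orbT.
by rewrite (component_closed cC uC yA euy).
Qed.

(* Gallai's lemma: being equal or not exposed together is a transitive relation
   containing adjacency. *)
Lemma connect_not_matchable A u w : ~~ matchable e A -> exposable e A = A ->
  connect (induced e A) u w -> u \in A -> u != w -> ~~ matchable e (A :\ u :\ w).
Proof.
move=> nA eA cuw uA nuw.
suff : w \in [set y in A | (u == y) || ~~ matchable e (A :\ u :\ y)].
  by rewrite inE (negbTE nuw) => /andP[].
apply: connect_closed cuw _; last by rewrite inE uA eqxx.
move=> v {nuw}w + /and3P[vA wA evw]; rewrite !inE wA vA /= => uv.
have nvw := adj_neq eirr evw.
have nm : ~ matchable e (A :\ v :\ w).
  move=> m; move/negP: nA; apply.
  have -> : A = v |: (w |: (A :\ v :\ w)) by set_points.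
  by apply: matchable_add; rewrite // !inE eqxx ?andbF.
have [//|/= nuw] := eqVneq u w; apply/negP => mY.
have [Euv|nuv] := eqVneq u v; first by subst u; apply: nm.
move: uv; rewrite (negbTE nuv) /= => /negP uv.
have /exposableP[v' [_ v'A nv'v mX]] : v \in exposable e A by rewrite eA.
have nv'w : v' != w by apply/negP => /eqP E; subst v'.
have nv'u : v' != u.
  apply/negP => /eqP E; subst v'; apply: uv.
  by have -> : A :\ u :\ v = A :\ v :\ u by rewrite !setDDl setUC.
(* The matching missing [u], [w] is switched from [v] against one missing [v], [v']. The end [w]
   yields [A :\ u :\ v], the end [u] yields [A :\ v :\ w], and the end [v'] yields all of [A]; none
   of these is matchable. *)
have [||z nzv] := matchable_exchange esym eirr mY mX (y := v).
- by rewrite !inE nvw eq_sym nuv.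
- by rewrite !inE eqxx andbF.
case=> -[zX zY mz mz'].
  move: zX zY; rewrite !inE nzv => /and3P[nzv' _ ->]; rewrite andbT negb_and !negbK.
  case/orP=> /eqP E; subst z.
    apply: uv; suff -> : A :\ u :\ v = w |: (A :\ u :\ w :\ v) by [].
    by set_points.
  apply: nm; suff -> : A :\ v :\ w = u |: (A :\ u :\ w :\ v) by [].
  by set_points.
move: zX zY; rewrite !inE nzv => /and3P[nzw nzu ->]; rewrite !andbT negbK.
move=> /eqP E; subst z; move/negP: nA; apply.
suff -> : A = v |: (v' |: (A :\ v :\ v')) by [].
by set_points.
Qed.

(** Two vertices missed together lie in different components, so restricting the matching to either
    component shows it factor-critical. A third component would be fully covered, although its order
    is odd. *)
Lemma exposable_components A : A != set0 -> ~~ matchable e A ->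
  exposable e A = A ->
  #|components e A| = 2 /\
  forall C, C \in components e A -> factor_critical e C.
Proof.
move=> /set0Pn[u uA] nA eA.
have sep C v v' : C \in components e A -> v \in C -> v' != v ->
    matchable e (A :\ v :\ v') -> v' \in A -> v' \notin C.
  move=> cC vC nv'v m v'A; apply/negP => v'C.
  have [vA EC] := component_eq cC vC; move: v'C; rewrite EC inE => /andP[_ cvv'].
  have := connect_not_matchable nA eA cvv' vA; rewrite eq_sym => /(_ nv'v).
  by rewrite m.
have fc C : C \in components e A -> factor_critical e C.
  move=> cC v vC; apply/matchableP; have vA := subsetP (component_sub cC) _ vC.
  have /exposableP[v' [_ v'A nv'v m]] : v \in exposable e A by rewrite eA.
  have v'C := sep _ _ _ cC vC nv'v m v'A.
  have -> : C :\ v = (A :\ v :\ v') :&: C.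
    apply/setP => w; rewrite !inE; have [wC|_] := boolP (w \in C).
      by rewrite (subsetP (component_sub cC) _ wC) !andbT (memPn v'C).
    by rewrite !andbF.
  apply: matchable_component cC _ m.
  by apply: subset_trans (subD1set _ _) (subD1set _ _).
split=> //.
have /exposableP[u' [_ u'A nu'u m]] : u \in exposable e A by rewrite eA.
have compE v : v \in A ->
    [set y in A | connect (induced e A) v y] \in components e A.
  by move=> vA; apply/componentsP; exists v.
set C := [set y in A | connect (induced e A) u y].
set C' := [set y in A | connect (induced e A) u' y].
have uC : u \in C by rewrite inE uA connect0.
have u'C' : u' \in C' by rewrite inE u'A connect0.
have u'C : u' \notin C := sep _ _ _ (compE _ uA) uC nu'u m u'A.
have -> : components e A = [set C; C'].
  apply/setP => D; rewrite !inE; apply/idP/orP => [cD|[]/eqP->]; last 2 first.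
  - exact: compE.
  - exact: compE.
  have [uD|uD] := boolP (u \in D).
    by left; apply/eqP; have [] := component_eq cD uD.
  have [u'D|u'D] := boolP (u' \in D).
    by right; apply/eqP; have [] := component_eq cD u'D.
  have [v vD] := component_neq0 cD.
  have : matchable e ((A :\ u :\ u') :&: D).
    apply: matchable_component cD _ m.
    by apply: subset_trans (subD1set _ _) (subD1set _ _).
  have -> : (A :\ u :\ u') :&: D = D.
    apply/setP => w; rewrite !inE; have [wD|_] := boolP (w \in D).
      by rewrite (subsetP (component_sub cD) _ wD) !andbT (memPn u'D) ?(memPn uD).
    by rewrite !andbF.
  by move/(matchable_even esym eirr); rewrite (factor_critical_odd (fc _ cD) vD).
rewrite cards2; suff -> : C != C' by [].
by apply: contraNneq u'C => ->.
Qed.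

End Components.

(** * Consequences of extendability, and the minimum degree *)

Section Extendable.

Variables (V : finType) (e : rel V) (k : nat).
Hypotheses (eirr : irreflexive e) (ek : extendable e k).

Lemma card_cover_matching (M : {set {set V}}) : matching e M ->
  #|cover M| = 2 * #|M|.
Proof.
case/andP=> /subsetP Me /eqP <-.
rewrite (eq_bigr (fun=> 2)); first by rewrite sum_nat_const mulnC.
move=> E /Me /imsetP[[x y]]; rewrite inE /= => exy ->.
by rewrite cards2 (adj_neq eirr exy).
Qed.

Lemma extendable_matchableT : matchable e [set: V].
Proof.
have [_ _ [M [mM cM]] ext] := ek; have [N pN _] := ext M mM cM.
by apply/existsP; exists N.
Qed.

(** A perfect matching of G[X] has [k] edges; the edges added when it is extended to G match the
    complement. *)
Lemma extendable_matchableC (X : {set V}) : #|X| = 2 * k ->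
  matchable e X -> matchable e (~: X).
Proof.
move=> cX /existsP[M /andP[mM /eqP cM]].
have cardM : #|M| = k.
  by apply/eqP; rewrite -(@eqn_pmul2l 2) // -card_cover_matching // cM cX.
have [_ _ _ ext] := ek.
have [N /andP[/andP[Ne Nt] /eqP cN] MN] := ext M mM cardM.
apply/existsP; exists (N :\: M); apply/andP; split.
  rewrite /matching trivIsetD // andbT.
  by apply: subset_trans Ne; apply: subsetDl.
rewrite -cM; apply/eqP/setP => w; rewrite inE; apply/bigcupP/idP.
  case=> E /setDP[EN EM] wE; apply/bigcupP => -[F FM wF].
  have FN := subsetP MN _ FM; move/negP: EM; apply.
  by rewrite -(def_pblock Nt EN wE) (def_pblock Nt FN wF).
move=> wM; have : w \in cover N by rewrite cN inE.
case/bigcupP=> E EN wE; exists E => //; rewrite inE EN andbT.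
by apply: contra wM => EM; apply/bigcupP; exists E.
Qed.

End Extendable.

Lemma min_degree_le (V : finType) (e : rel V) (x : V) : min_degree e <= degree e x.
Proof.
rewrite /min_degree; elim: (index_enum V) (mem_index_enum x) => //= y s IHs.
rewrite inE big_cons => /predU1P[->|/IHs]; first exact: geq_minl.
by apply: leq_trans; apply: geq_minr.
Qed.

(** The hypothesis excludes the starting value of the iterated minimum, the one value that no vertex
    need attain. *)
Lemma min_degree_attained (V : finType) (e : rel V) :
  min_degree e < #|V| -> exists x, degree e x = min_degree e.
Proof.
suff [-> | //] : min_degree e = #|V| \/ exists x, degree e x = min_degree e.
  by rewrite ltnn.
rewrite /min_degree; elim/big_rec: _ => [|x m _ IH]; first by left.
by case: (leqP (degree e x) m) => _; [right; exists x | exact: IH].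
Qed.

(** Decidability makes it possible to argue by contradiction and to extract a bad set from a
    failure. *)
Lemma n_factor_criticalP (V : finType) (e : rel V) (n : nat) :
  reflect (n_factor_critical e n)
    ((n + 2 <= #|V|) && [forall (S : {set V} | #|S| == n), matchable e (~: S)]).
Proof.
apply: (iffP andP) => -[leV mS]; split=> //.
  by move=> S /eqP cS; apply/matchableP; apply: (forall_inP mS).
by apply/forall_inP => S /eqP /mS /matchableP.
Qed.

Lemma not_factor_critical_halves (k : nat) (V : finType) (e : rel V) :
  1 <= k -> simple_graph e -> extendable e k -> #|V| = 4 * k ->
  2 * k < min_degree e -> ~ n_factor_critical e (2 * k) ->
  exists V1 V2 : {set V},
    [/\ V1 :|: V2 = [set: V], [disjoint V1 & V2],
        #|V1| = 2 * k /\ #|V2| = 2 * k,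
        two_factor_critical_components e V1
      & two_factor_critical_components e V2].
Proof.
move=> k1 [esym eirr] ek cV dk nfc.
have deg_gt v : 2 * k < degree e v by apply: leq_trans dk (min_degree_le _ _).
have mC := extendable_matchableC eirr ek.
have mT := extendable_matchableT ek.
have [A0 cA0 nA0] : exists2 A : {set V}, #|A| = 2 * k & ~~ matchable e A.
  move/n_factor_criticalP: nfc; rewrite cV -[4]/(2 + 2) mulnDl leq_add2l.
  rewrite leq_pmulr //= negb_forall_in => /exists_inP[S /eqP cS nS].
  by exists (~: S) => //; apply: card_half.
have [A nmA] := exists_near_matchable esym eirr mT cA0 nA0.
have nmB := near_matchableC esym eirr cV deg_gt mC nmA.
have comps X : near_matchable e k X -> unexposable e X = set0 ->
    two_factor_critical_components e X.
  case=> cX nX /set0Pn[u uD] U0.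
  have eX : exposable e X = X.
    by apply/eqP; rewrite eqEsubset exposable_sub -setD_eq0; apply/eqP.
  have X0 : X != set0 by apply/set0Pn; exists u; rewrite -eX.
  have [c2 fc] := exposable_components esym eirr X0 nX eX.
  split=> // C cC; split; first exact: fc.
  have [v vC] := component_neq0 cC.
  have oC := factor_critical_odd esym eirr (fc _ cC) vC.
  (* With only [2 * k] vertices outside [X], the degree bound gives [1 < #|C|]; oddness then gives
     3. *)
  have := leq_ltn_trans (deg_gt v) (degree_component esym eirr cC vC).
  rewrite (card_half cV cX) -[(2 * k).+1]add1n ltn_add2r.
  by case: #|C| oC => [|[|[]]].
have [cA _ _] := nmA.
exists A, (~: A); split.
- exact: setUCr.
- by rewrite -setI_eq0 setICr.
- by rewrite (card_half cV).
- by apply: comps => //; rewrite -[A]setCK; apply: unexposable0 nmB.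
- by apply: comps => //; apply: unexposable0 nmA.
Qed.

Theorem theorem7 (k : nat) (V : finType) (e : rel V) :
  1 <= k ->
  simple_graph e ->
  connected e ->
  ~ bipartite e ->
  extendable e k ->
  #|V| = 4 * k ->
  [/\ (3 * k <= min_degree e -> n_factor_critical e (2 * k)),
      (min_degree e = 2 * k -> ~ n_factor_critical e (2 * k))
    & (2 * k + 1 <= min_degree e <= 3 * k - 1 ->
       (~ n_factor_critical e (2 * k) <->
        exists V1 V2 : {set V},
          [/\ V1 :|: V2 = [set: V], [disjoint V1 & V2],
              #|V1| = 2 * k /\ #|V2| = 2 * k,
              two_factor_critical_components e V1
            & two_factor_critical_components e V2]))].
Proof.
move=> k1 se ce nbip ek cV; have [esym eirr] := se; split.
- move=> dk; apply/n_factor_criticalP; apply: contraT => /n_factor_criticalP nfc.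
  have lt2k : 2 * k < min_degree e by apply: leq_trans dk; rewrite ltn_mul2r k1.
  have [A [_ [_ _ [cA _] [c2 _] _]]] :=
    not_factor_critical_halves k1 se ek cV lt2k nfc.
  (* A vertex of degree at least [3 * k] has at most [2 * k] neighbours outside [A], so each of the
     two components of G[A] has at least [k.+1] vertices. *)
  suff : 2 * k.+1 <= 2 * k by rewrite leq_mul2l ltnn.
  rewrite -[X in _ <= X]cA (card_partition (components_partition esym A)) -c2.
  rewrite -sum_nat_const; apply: leq_sum => C cC.
  have [v vC] := component_neq0 cC.
  have := leq_ltn_trans (min_degree_le e v) (degree_component esym eirr cC vC).
  move/(leq_ltn_trans dk).
  by rewrite (card_half cV cA) (mulSn 2) ltn_add2r.
- move=> dk [_ fc].
  have [|v dv] := @min_degree_attained _ e.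
    by rewrite dk cV ltn_mul2r k1.
  (* Deleting the [2 * k] neighbours of a vertex of minimum degree isolates it. *)
  have /matchableP m := fc [set y | e v y] (etrans dv dk).
  have [|y [evy yN _]] := matchable_del esym m (x := v).
    by rewrite !inE eirr.
  by move: yN; rewrite !inE evy.
case/andP; rewrite addn1 => dk _; split=> [nfc|[V1 [V2 [V12 dV [cV1 cV2]]]]].
  exact: not_factor_critical_halves.
move=> _ [c2 fc2] [_ /(_ V1 cV1)].
have -> : ~: V1 = V2.
  apply/setP => w; rewrite inE; have := in_setT w; rewrite -V12 inE.
  have [wV1|//] := boolP (w \in V1).
  by rewrite (disjointFr dV wV1).
(* Deleting [V1] leaves G[V2], in which a single odd component already rules out a perfect
   matching. *)
have [C cC] : exists C, C \in components e V2.
  by apply/set0Pn; rewrite -card_gt0 c2.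
have [v vC] := component_neq0 cC.
move/matchableP/(matchable_component esym eirr cC (subxx _)).
rewrite (setIidPr (component_sub esym cC)) => /(matchable_even esym eirr).
by rewrite (factor_critical_odd esym eirr (proj1 (fc2 _ cC)) vC).
Qed.
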